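(* For indeterminates $t,u,x_1,\dots,x_n,y_1,\dots,y_n$, writing $\bar y_i=1/y_i$, $$\sum_{\lambda}\prod_{i=1}^{n}(1-ut^{\lambda_i-i+n})\,s_\lambda(x_1,\dots,x_n)\,sp_\lambda(y_1^{\pm1},\dots,y_n^{\pm1})=\frac{\det_{1\le i,j\le n}\left[\dfrac{1-u+(u-t)(x_iy_j+x_i\bar y_j)+(t^2-u)x_i^2}{(1-x_iy_j)(1-tx_iy_j)(1-x_i\bar y_j)(1-tx_i\bar y_j)}\right]}{\prod_{1\le i<j\le n}(x_i-x_j)(y_i-y_j)(1-\bar y_i\bar y_j)},$$ where the sum is over all partitions $\lambda$ of length at most $n$.
   Context: $s_\lambda$ is the Schur polynomial and $sp_\lambda(y_1^{\pm1},\dots,y_n^{\pm1})$ is the symplectic Schur polynomial (irreducible $Sp_{2n}$ character), given by $sp_\lambda=\det_{i,j}[y_j^{\lambda_i-i+n+1}-y_j^{-(\lambda_i-i+n+1)}]\big/\det_{i,j}[y_j^{n-i+1}-y_j^{-(n-i+1)}]$. Identity of formal power series in the $x$'s. *)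

(* Defs.v *)
From HB Require Import structures.
From mathcomp Require Import all_boot all_order all_algebra.
From mathcomp Require Import boolp.
From mathcomp Require Import mpoly.

Set Implicit Arguments.
Unset Strict Implicit.
Unset Printing Implicit Defensive.

Import GRing.Theory.

Local Open Scope ring_scope.

(* Formal power series in n commuting variables: an arbitrary coefficient      *)
(* function on the monomials 'X_{1..n}.                                        *)
Record fps (n : nat) (R : Type) := FPS { fps_coef : 'X_{1..n} -> R }.

Arguments FPS {n R} _.
Arguments fps_coef {n R} _ _.

HB.instance Definition _ (n : nat) (R : Type) := gen_eqMixin (fps n R).
HB.instance Definition _ (n : nat) (R : Type) := gen_choiceMixin (fps n R).

Lemma fpsP (n : nat) (R : Type) (f g : fps n R) :
  (forall m, fps_coef f m = fps_coef g m) -> f = g.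
Proof. by case: f g => [f] [g] /= fg; congr FPS; apply/funext. Qed.

Section FpsRing.
Context (n : nat) (R : comNzRingType).
Implicit Types f g h : fps n R.

Definition fps_zero : fps n R := FPS (fun=> 0).
Definition fps_opp f : fps n R := FPS (fun m => - fps_coef f m).
Definition fps_add f g : fps n R := FPS (fun m => fps_coef f m + fps_coef g m).

Definition fpsC (c : R) : fps n R := FPS (fun m => c *+ (m == 0%MM)).
Definition fpsX (i : 'I_n) : fps n R := FPS (fun m => (m == U_(i)%MM)%:R).

Definition fps_mul f g : fps n R :=
  FPS (fun m => \sum_(k : 'X_{1..n < (mdeg m).+1} | (k <= m)%MM)
                  fps_coef f k * fps_coef g (m - k)%MM).

Let addA : associative fps_add.
Proof. by move=> f g h; apply: fpsP => m /=; rewrite addrA. Qed.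
Let addC : commutative fps_add.
Proof. by move=> f g; apply: fpsP => m /=; rewrite addrC. Qed.
Let add0 : left_id fps_zero fps_add.
Proof. by move=> f; apply: fpsP => m /=; rewrite add0r. Qed.
Let addN : left_inverse fps_zero fps_opp fps_add.
Proof. by move=> f; apply: fpsP => m /=; rewrite addNr. Qed.

HB.instance Definition _ := GRing.isZmodule.Build (fps n R) addA addC add0 addN.

(* The ring axioms are transferred from polynomials by truncation. *)
Definition fps_trunc (d : nat) f : {mpoly R[n]} :=
  \sum_(k : 'X_{1..n < d}) fps_coef f k *: 'X_[k].

Lemma mcoeff_fps_trunc d f m :
  (mdeg m < d)%N -> (fps_trunc d f)@_m = fps_coef f m.
Proof. exact: mcoeff_mpoly. Qed.

Lemma mcoeffM_low (p p' q q' : {mpoly R[n]}) m :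
  (forall k, (mdeg k <= mdeg m)%N -> p@_k = p'@_k) ->
  (forall k, (mdeg k <= mdeg m)%N -> q@_k = q'@_k) ->
  (p * q)@_m = (p' * q')@_m.
Proof.
move=> pp' qq'; rewrite !mcoeffM; apply: eq_bigr => -[k1 k2] _ /=.
by rewrite pp' ?qq' // -ltnS bmdeg.
Qed.

Lemma fps_coefM d f g m : (mdeg m < d)%N ->
  fps_coef (fps_mul f g) m = (fps_trunc d f * fps_trunc d g)@_m.
Proof.
move=> md; transitivity ((fps_trunc (mdeg m).+1 f * fps_trunc (mdeg m).+1 g)@_m).
  rewrite [RHS](mcoeff_poly_mul_lin _ _ (ltnSn (mdeg m))) /=.
  apply: eq_bigr => k _; rewrite !mcoeff_fps_trunc ?bmdeg //.
  by rewrite ltnS mdegB.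
by apply: mcoeffM_low => k km; rewrite !mcoeff_fps_trunc ?ltnS // (leq_ltn_trans km).
Qed.

Let mulC : commutative fps_mul.
Proof.
by move=> f g; apply: fpsP => m; rewrite !(fps_coefM _ _ (ltnSn (mdeg m))) mulrC.
Qed.

Let mulA : associative fps_mul.
Proof.
move=> f g h; apply: fpsP => m; have md := ltnSn (mdeg m).
rewrite !(fps_coefM _ _ md).
transitivity ((fps_trunc (mdeg m).+1 f *
               (fps_trunc (mdeg m).+1 g * fps_trunc (mdeg m).+1 h))@_m).
  apply: mcoeffM_low => // k km.
  by rewrite mcoeff_fps_trunc ?ltnS // (@fps_coefM (mdeg m).+1).
rewrite mulrA; apply: mcoeffM_low => // k km.
by rewrite mcoeff_fps_trunc ?ltnS // (@fps_coefM (mdeg m).+1).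
Qed.

Let mul1 : left_id (fpsC 1) fps_mul.
Proof.
move=> f; apply: fpsP => m; rewrite (fps_coefM _ _ (ltnSn (mdeg m))).
transitivity ((1 * fps_trunc (mdeg m).+1 f)@_m).
  apply: mcoeffM_low => // k km.
  by rewrite mcoeff_fps_trunc ?ltnS //= mcoeff1.
by rewrite mul1r mcoeff_fps_trunc.
Qed.

Let mulDl : left_distributive fps_mul fps_add.
Proof.
move=> f g h; apply: fpsP => m /=; rewrite -big_split /=.
by apply: eq_bigr => k _; rewrite mulrDl.
Qed.

Let one_neq0 : fpsC 1 != 0.
Proof.
apply/eqP => /(congr1 (fun f => fps_coef f 0%MM)) /= /eqP.
by rewrite eqxx oner_eq0.
Qed.

HB.instance Definition _ := GRing.Zmodule_isComNzRing.Build (fps n R)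
  mulA mulC mul1 mulDl one_neq0.

End FpsRing.

Arguments fpsC n {R} c.
Arguments fpsX {n} R i.

Section FpsIdomain.
Context (n : nat) (R : idomainType).
Implicit Types f g : fps n R.

Definition fps_unit : pred (fps n R) := fun f => `[< exists g, g * f = 1 >].
Definition fps_inv f : fps n R :=
  if pselect (exists g, g * f = 1) is left e then sval (cid e) else f.

Let mulV : {in fps_unit, left_inverse 1 fps_inv *%R}.
Proof.
move=> f /asboolP fU; rewrite /fps_inv.
by case: pselect => // e; case: cid.
Qed.

Let intro_unit f g : g * f = 1 -> fps_unit f.
Proof. by move=> gf; apply/asboolP; exists g. Qed.

Let inv_out : {in [predC fps_unit], fps_inv =1 id}.
Proof.
move=> f /negP fU; rewrite /fps_inv; case: pselect => // e.
by case: fU; apply/asboolP.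
Qed.

HB.instance Definition _ := GRing.ComNzRing_hasMulInverse.Build (fps n R)
  mulV intro_unit inv_out.

Lemma fps_low_coef f : f != 0 -> exists m,
  fps_coef f m != 0 /\ forall k, (k < m)%O -> fps_coef f k = 0.
Proof.
move=> f0; apply: contrapT => noM; case/eqP: f0; apply: fpsP => m /=.
elim/(@ltmwf n): m => m IH; apply/eqP; apply/negPn/negP => fm.
by apply: noM; exists m; split.
Qed.

Let mul_eq0 f g : f * g = 0 -> (f == 0) || (g == 0).
Proof.
apply: contra_eqT; rewrite negb_or => /andP[].
move=> /fps_low_coef [a [fa lta]] /fps_low_coef [b [gb ltb]].
apply/eqP => /(congr1 (fun h => fps_coef h (a + b)%MM)) /=.
have da : (mdeg a < (mdeg (a + b)%MM).+1)%N by rewrite ltnS mdegD leq_addr.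
rewrite (bigD1 (BMultinom da)) ?lem_addr //= big1 ?addr0.
  by rewrite addmC addmK; apply/eqP; rewrite mulf_neq0.
move=> k /andP[kab ka]; have [|ak|/eqP] := Order.TotalTheory.ltgtP (bmnm k) a.
- by move=> /lta ->; rewrite mul0r.
- rewrite (ltb (a + b - k)%MM) ?mulr0 //.
  rewrite -(ltmc_add2l _ _ (bmnm k)) submK // [X in (_ < X)%O]addmC.
  by rewrite ltmc_add2l.
- by move=> kE; case/negP: ka; rewrite bmeqP.
Qed.

HB.instance Definition _ := GRing.ComUnitRing_isIntegral.Build (fps n R) mul_eq0.

End FpsIdomain.

(* Summation of a family of power series: only finitely many members           *)
(* contribute to a given coefficient, and the coefficients add up to those     *)
(* of the sum.                                                                 *)
Definition fps_has_sum (n : nat) (R : nmodType) (I : eqType)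
    (g : I -> fps n R) (G : fps n R) : Prop :=
  forall m : 'X_{1..n}, exists s : seq I,
    [/\ uniq s, forall i, i \notin s -> fps_coef (g i) m = 0
      & fps_coef G m = \sum_(i <- s) fps_coef (g i) m].

(* The same for expressions such as det / det, which are written in the        *)
(* fraction field of the ring of power series and whose values are required    *)
(* to be power series.                                                         *)
Definition formal_sum (n : nat) (R : idomainType) (I : eqType)
    (g : I -> {fraction fps n R}) (G : {fraction fps n R}) : Prop :=
  exists (g' : I -> fps n R) (G' : fps n R),
    [/\ forall i, g i = FracField.tofrac (g' i),
        G = FracField.tofrac G' & fps_has_sum g' G'].

(* Partitions of length at most n, padded with zeros to exactly n parts. *)
Definition partition_le (n : nat) := {l : n.-tuple nat | sorted geq l}.

Definition part (n : nat) (l : partition_le n) (i : 'I_n) : nat :=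
  tnth (val l) i.

(* The exponent lambda_i - i + n for the 1-based index i, hence the i.+1 for   *)
(* the 0-based ordinal; the subtraction is never truncated.                    *)
Definition pexp (n : nat) (l : partition_le n) (i : 'I_n) : nat :=
  (part l i + (n - i.+1))%N.

(* Both polynomials are the quotients of alternants of Weyl's character        *)
(* formula, meaningful where the denominator does not vanish, in particular    *)
(* at indeterminates.                                                          *)
Definition schur (F : fieldType) (n : nat) (x : 'I_n -> F)
    (l : partition_le n) : F :=
  \det (\matrix_(i < n, j < n) x j ^+ pexp l i) /
  \det (\matrix_(i < n, j < n) x j ^+ (n - i.+1)).

Definition sp_schur (F : fieldType) (n : nat) (y : 'I_n -> F)
    (l : partition_le n) : F :=
  \det (\matrix_(i < n, j < n) (y j ^+ (pexp l i).+1 - y j ^- (pexp l i).+1)) /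
  \det (\matrix_(i < n, j < n) (y j ^+ (n - i.+1).+1 - y j ^- (n - i.+1).+1)).

Section Indeterminates.
Context (R : idomainType) (n : nat).

(* The field R(t, u, y_1, ..., y_n) of coefficients and the fraction field of  *)
(* the ring of power series in x_1, ..., x_n over it.                          *)
Definition coefF : fieldType := {fraction {mpoly R[2 + n]}}.
Definition seriesF : fieldType := {fraction fps n coefF}.

Definition indet (i : 'I_(2 + n)) : seriesF :=
  FracField.tofrac (fpsC n (FracField.tofrac 'X_i : coefF)).

Definition ind_t : seriesF := indet (lshift n 0).
Definition ind_u : seriesF := indet (lshift n 1).
Definition ind_y (j : 'I_n) : seriesF := indet (rshift 2 j).
Definition ind_x (i : 'I_n) : seriesF := FracField.tofrac (fpsX coefF i).

End Indeterminates.

(* Main.v *)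
Require Import Defs.
From HB Require Import structures.
From mathcomp Require Import all_boot all_order all_fingroup all_algebra.
From mathcomp Require Import boolp.
From mathcomp Require Import mpoly.
From mathcomp Require Import zify ring.

(* Multiplied by the Vandermonde determinant of the x's and the Weyl          *)
(* denominator of the y's, the left-hand side is a Cauchy-Binet expansion,    *)
(* over exponents l_1 > ... > l_n, of the determinant of                      *)
(*   sum_k (1 - u t^k) x_i^k (y_j^(k+1) - y_j^-(k+1)),                        *)
(* a combination of four geometric series with value (y_j - 1/y_j) times the  *)
(* (i, j) entry on the right.                                                 *)
(* To stay inside power series, each x_j^k is reduced modulo                  *)
(* prod_j ('X - x_j): x_j^k = sum_q c_(k,q) x_j^(n-q) with c_(k,q) of order   *)
(* at least k - n. This factors the Vandermonde determinant out of every      *)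
(* alternant, leaving s_lambda = det c_(l_i,q), and of the right-hand side,   *)
(* leaving the determinant of the convergent sums over k. Cauchy-Binet is     *)
(* then applied to the truncations k < N, modulo the power series of order    *)
(* at least N - n.                                                            *)

Set Implicit Arguments.
Unset Strict Implicit.
Unset Printing Implicit Defensive.

Import GRing.Theory.

Local Open Scope ring_scope.

(** * Order of a power series *)

(** Two evaluations of [\det kernel_mx] give the identity. By the reduction of powers, the (i, j)
    entry of [vandermonde_mx^T *m kernel_mx] is the sum over k of [kernel_coef k j] times x_i^k.
    [kernel_mxE] evaluates it as y_j - 1/y_j times the entry on the right-hand side, so the
    determinant of those entries is, up to the product of the y_j - 1/y_j, the Vandermonde
    determinant times [\det kernel_mx].

    On the other hand, [has_sum_summand_fps] expands [\det kernel_mx] by [det_mulmx_Cauchy_Binet]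
    over strictly decreasing exponents, that is, over partitions: one minor is [schur_fps], the
    other is the product of the 1 - u t^(l_i) times the symplectic alternant. Dividing by the Weyl
    denominator, factored in [det_Weyl_denominator_C], produces sp_lambda, cancels the y_j - 1/y_j
    and leaves the product on the right. [formal_sum_schur_sp] assembles this over any field with
    suitable y. *)

Definition fps_order (n : nat) (R : nmodType) (d : nat) (f : fps n R) :=
  forall m : 'X_{1..n}, (mdeg m < d)%N -> fps_coef f m = 0.

Section FpsOrder.
Variables (n : nat) (R : comNzRingType).
Implicit Types (f g : fps n R) (d e : nat).

Lemma fps_coef_sum (I : Type) (r : seq I) (P : pred I) (F : I -> fps n R) m :
  fps_coef (\sum_(i <- r | P i) F i) m = \sum_(i <- r | P i) fps_coef (F i) m.
Proof. by apply: (big_morph (fun f => fps_coef f m)). Qed.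

Lemma fps_order_le d e f : (e <= d)%N -> fps_order d f -> fps_order e f.
Proof. by move=> ed fd m me; apply/fd/(leq_trans me). Qed.

Lemma fps_order0 d : fps_order d (0 : fps n R).
Proof. by []. Qed.

Lemma fps_orderD d f g : fps_order d f -> fps_order d g -> fps_order d (f + g).
Proof. by move=> fd gd m md /=; rewrite fd ?gd ?addr0. Qed.

Lemma fps_orderN d f : fps_order d f -> fps_order d (- f).
Proof. by move=> fd m md /=; rewrite fd ?oppr0. Qed.

Lemma fps_orderB d f g : fps_order d f -> fps_order d g -> fps_order d (f - g).
Proof. by move=> fd gd; apply/fps_orderD/fps_orderN. Qed.

Lemma fps_orderM d e f g :
  fps_order d f -> fps_order e g -> fps_order (d + e) (f * g).
Proof.
move=> fd ge m mde; apply: big1 => k km.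
case: (ltnP (mdeg k) d) => [kd | dk]; first by rewrite fd ?mul0r.
rewrite [X in _ * X]ge ?mulr0 //.
move: mde; rewrite -{1}(submK km) mdegD addnC; set a := mdeg (m - k)%MM.
by move=> h; rewrite -(ltn_add2l d); apply: leq_ltn_trans h; rewrite leq_add2r.
Qed.

Lemma fps_orderMl d f g : fps_order d g -> fps_order d (f * g).
Proof. by move=> gd; apply: (@fps_orderM 0). Qed.

Lemma fps_orderMr d f g : fps_order d f -> fps_order d (f * g).
Proof. by rewrite mulrC; apply: fps_orderMl. Qed.

Lemma fps_order_sum d (I : Type) (r : seq I) (P : pred I) (F : I -> fps n R) :
  (forall i, P i -> fps_order d (F i)) -> fps_order d (\sum_(i <- r | P i) F i).
Proof. by move=> Fd; apply: big_ind => //; apply: fps_orderD. Qed.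

Lemma fps_orderX d i : fps_order d (fpsX R i ^+ d : fps n R).
Proof.
have X1 : fps_order 1 (fpsX R i : fps n R).
  move=> m; rewrite ltnS leqn0 mdeg_eq0 => /eqP-> /=.
  by rewrite eq_sym mnm1_eq0.
by elim: d => // d IH; rewrite exprS; apply: (@fps_orderM 1).
Qed.

Lemma fps_order_det_row d k (A : 'M[fps n R]_k) i :
  (forall j, fps_order d (A i j)) -> fps_order d (\det A).
Proof.
move=> Ad; apply: fps_order_sum => s _; apply: fps_orderMl.
by rewrite (bigD1 i) //=; apply: fps_orderMr.
Qed.

(** Series of order at least [d] form an ideal, and the determinant is a polynomial in the entries,
    so it respects congruence modulo this ideal. *)
Lemma fps_order_subr_det d k (A B : 'M[fps n R]_k) :
  (forall i j, fps_order d (A i j - B i j)) -> fps_order d (\det A - \det B).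
Proof.
move=> AB; rewrite /determinant -sumrB; apply: fps_order_sum => s _.
rewrite -mulrBr; apply: fps_orderMl.
apply: (big_ind2 (fun f g => fps_order d (f - g))) => // [|f f' g g' ff gg].
  by rewrite subrr; apply: fps_order0.
have -> : f * g - f' * g' = f * (g - g') + (f - f') * g'.
  by rewrite mulrBr mulrBl addrA subrK.
by apply: fps_orderD; [apply: fps_orderMl | apply: fps_orderMr].
Qed.

Lemma fps_order_eq f g : (forall d, fps_order d (f - g)) -> f = g.
Proof.
move=> fg; apply: fpsP => m; apply/eqP; rewrite -subr_eq0; apply/eqP.
exact: (fg (mdeg m).+1 m).
Qed.

Lemma fpsC_is_zmod_morphism : zmod_morphism (@fpsC n R).
Proof. by move=> a b; apply: fpsP => m /=; rewrite mulrnBl. Qed.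

Lemma fpsC_is_monoid_morphism : monoid_morphism (@fpsC n R).
Proof.
split=> // a b; apply: fpsP => m /=.
have m0 : (mdeg (0%MM : 'X_{1..n}) < (mdeg m).+1)%N by rewrite mdeg0.
rewrite (bigD1 (BMultinom m0)) /=; last by apply/mnm_lepP => i; rewrite mnm0E.
rewrite subm0 eqxx big1 ?addr0.
  by rewrite mulr1n mulrnAr.
move=> k /andP[_ k0].
by rewrite (_ : _ == _ = false) ?mul0r //; apply/negbTE; rewrite bmeqP in k0.
Qed.

(** The infinite sum of the [F k], meant for [F k] of order at least [k - e]: then no index above
    [mdeg m + e] reaches the coefficient at [m]. *)
Definition fps_series e (F : nat -> fps n R) : fps n R :=
  FPS (fun m => \sum_(k < (mdeg m + e).+1) fps_coef (F k) m).

Lemma fps_seriesP e F : (forall k, fps_order (k - e) (F k)) ->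
  forall N, fps_order (N - e) (fps_series e F - \sum_(k < N) F k).
Proof.
move=> Fo N m mN /=; rewrite fps_coef_sum.
have mN' : ((mdeg m + e).+1 <= N)%N by lia.
rewrite (big_ord_widen _ (fun k => fps_coef (F k) m) mN') big_mkcond /=.
rewrite -sumrB big1 // => k _; case: ifPn => [_ | km]; first by rewrite subrr.
by rewrite (Fo k m) ?subrr //; lia.
Qed.
End FpsOrder.

HB.instance Definition _ (n : nat) (R : comNzRingType) :=
  GRing.isZmodMorphism.Build R (fps n R) (@fpsC n R)
    (@fpsC_is_zmod_morphism n R).
HB.instance Definition _ (n : nat) (R : comNzRingType) :=
  GRing.isMonoidMorphism.Build R (fps n R) (@fpsC n R)
    (@fpsC_is_monoid_morphism n R).

(** * The Cauchy-Binet formula *)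

(** Subsets of size [n] are listed in decreasing order so as to match the exponents [pexp l] of a
    partition. *)
Definition decreasing_ffun n N (f : {ffun 'I_n -> 'I_N}) :=
  [forall i : 'I_n, forall j : 'I_n, (i < j)%N ==> (f j < f i)%N].

Lemma decreasing_ffunP n N (f : {ffun 'I_n -> 'I_N}) :
  reflect (forall i j : 'I_n, (i < j)%N -> (f j < f i)%N) (decreasing_ffun f).
Proof.
apply: (iffP forallP) => [fd i j ij | fd i]; last first.
  by apply/forallP => j; apply/implyP; apply: fd.
by move/(_ i)/forallP/(_ j)/implyP/(_ ij): fd.
Qed.

Lemma decreasing_ffun_sorted n N (f : {ffun 'I_n -> 'I_N}) :
  decreasing_ffun f = sorted gtn [seq val (f i) | i <- enum 'I_n].
Proof.
rewrite sorted_map; apply/decreasing_ffunP/idP => [fd | fs i j ij].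
  apply: (@sub_sorted _ (relpre val ltn)) => [i j /fd // |].
  by rewrite -sorted_map val_enum_ord iota_ltn_sorted.
have /(sorted_ltn_nth _ i) := fs.
have tr : transitive (relpre (fun i => val (f i)) gtn).
  by move=> a b c /= h1 h2; apply: ltn_trans h2 h1.
move=> /(_ tr i j); rewrite !inE !size_enum_ord !ltn_ord !nth_ord_enum.
by move=> /(_ isT isT ij).
Qed.

Lemma perm_decreasing_ex n N (g : {ffun 'I_n -> 'I_N}) : injective g ->
  exists s : 'S_n, decreasing_ffun [ffun i => g (s i)].
Proof.
move=> g_inj; pose t := [tuple val (g i) | i < n].
have /tuple_permP[s ts] : perm_eq (sort geq t) t by rewrite perm_sort.
exists s; rewrite decreasing_ffun_sorted.
have -> : [seq val ([ffun i => g (s i)] i) | i <- enum 'I_n] = sort geq t.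
  by rewrite ts; apply: eq_map => i; rewrite ffunE tnth_mktuple.
rewrite gtn_sorted_uniq_geq sort_uniq sort_sorted ?andbT.
  by rewrite map_inj_uniq ?enum_uniq // => i j /val_inj/g_inj.
by move=> a b /=; apply: leq_total.
Qed.

(** Two strictly decreasing lists that are permutations of each other coincide. *)
Lemma perm_decreasing_uniq n N (g : {ffun 'I_n -> 'I_N}) (s s' : 'S_n) :
  injective g -> decreasing_ffun [ffun i => g (s i)] ->
  decreasing_ffun [ffun i => g (s' i)] -> s = s'.
Proof.
move=> g_inj; rewrite !decreasing_ffun_sorted => sd sd'.
have tr : transitive gtn by move=> a b c /= h1 h2; apply: ltn_trans h2 h1.
have asym : antisymmetric gtn by move=> a b /= /andP[]; lia.
have pg (p : 'S_n) : perm_eq [seq val ([ffun i => g (p i)] i) | i <- enum 'I_n]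
    [seq val (g i) | i <- enum 'I_n].
  rewrite (eq_map (_ : _ =1 (val \o g) \o p)) => [|i]; last by rewrite ffunE.
  rewrite map_comp; apply: perm_map; apply: uniq_perm; rewrite ?enum_uniq //.
    by rewrite map_inj_uniq ?enum_uniq //; apply: perm_inj.
  move=> i; rewrite mem_enum -[i](permKV p) mem_map ?mem_enum //.
  exact: perm_inj.
have /eq_in_map E := sorted_eq tr asym sd sd'
  (perm_trans (pg s) (etrans (perm_sym _ _) (pg s'))).
apply/permP => i; apply/g_inj/val_inj.
by have := E i; rewrite !ffunE mem_enum; apply.
Qed.

Lemma det_mulmx_ffun (R : comPzRingType) n N
    (A : 'M[R]_(n, N)) (B : 'M[R]_(N, n)) :
  \det (A *m B) = \sum_(g : {ffun 'I_n -> 'I_N})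
    (\prod_i A i (g i)) * \det (rowsub g B).
Proof.
transitivity (\sum_(s : 'S_n) \sum_(g : {ffun 'I_n -> 'I_N})
    (\prod_i A i (g i)) * ((-1) ^+ s * \prod_i B (g i) (s i))).
  apply: eq_bigr => s _; under eq_bigr do rewrite mxE.
  rewrite bigA_distr_bigA big_distrr; apply: eq_bigr => g _ /=.
  by rewrite big_split mulrCA.
rewrite exchange_big; apply: eq_bigr => g _; rewrite -big_distrr /=.
congr (_ * _); apply: eq_bigr => s _; congr (_ * _).
by apply: eq_bigr => i _; rewrite mxE.
Qed.

Theorem det_mulmx_Cauchy_Binet (R : comPzRingType) n N
    (A : 'M[R]_(n, N)) (B : 'M[R]_(N, n)) :
  \det (A *m B) = \sum_(f : {ffun 'I_n -> 'I_N} | decreasing_ffun f)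
    \det (colsub f A) * \det (rowsub f B).
Proof.
rewrite det_mulmx_ffun.
pose F (g : {ffun 'I_n -> 'I_N}) := (\prod_i A i (g i)) * \det (rowsub g B).
pose D (g : {ffun 'I_n -> 'I_N}) (s : 'S_n) :=
  decreasing_ffun [ffun i => g (s i)].
(* An injective [g] is sorted by exactly one [s]; for any other [g] the minor of [B] has a repeated
   row, so [F g] is zero. *)
transitivity (\sum_g \sum_(s : 'S_n | D g s) F g).
  apply: eq_bigr => g _.
  have [/injectiveP g_inj | /injectivePn[i [j ij gij]]] :=
    boolP (injectiveb g).
    have [s sd] := perm_decreasing_ex g_inj.
    rewrite (big_pred1 s) // => s'; apply/idP/eqP => [sd' | -> //].
    exact: perm_decreasing_uniq sd' sd.
  have F0 : F g = 0.
    rewrite /F (determinant_alternate ij) ?mulr0 // => k.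
    by rewrite !mxE gij.
  by rewrite -/(F g) F0 big1.
rewrite (exchange_big_dep predT) //=.
(* Substitute g = f o s^-1; for fixed [f], the signed sum over [s] then rebuilds the minor of
   [A]. *)
transitivity (\sum_(s : 'S_n) \sum_(f : {ffun 'I_n -> 'I_N} | decreasing_ffun f)
    F [ffun i => f (s^-1%g i)]).
  apply: eq_bigr => s _.
  pose h (f : {ffun 'I_n -> 'I_N}) := [ffun i => f (s^-1%g i)].
  rewrite (reindex h) /h /=.
    by apply: eq_bigl => f; rewrite /D; congr decreasing_ffun;
      apply/ffunP => i; rewrite !ffunE permK.
  exists (fun f : {ffun 'I_n -> 'I_N} => [ffun i => f (s i)]) => f _;
    by apply/ffunP => i; rewrite !ffunE ?permK ?permKV.
rewrite exchange_big; apply: eq_bigr => f _; rewrite /= /F.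
rewrite [X in X * _]/determinant mulr_suml.
rewrite (reindex_inj invg_inj); apply: eq_bigr => s _ /=.
rewrite invgK.
have -> : rowsub [ffun i => f (s i)] B = row_perm s (rowsub f B).
  by apply/matrixP => i j; rewrite !mxE ffunE.
rewrite row_permE det_mulmx det_perm mulrCA mulrA; congr (_ * _ * _).
by apply: eq_bigr => i _; rewrite !mxE ffunE.
Qed.

(** * Vandermonde and Weyl determinants *)

(** Reversing both rows and columns reduces this to increasing powers; the two signs cancel. *)
Lemma det_Vandermonde_rev (R : comPzRingType) n (x : 'I_n -> R) :
  \det (\matrix_(i < n, j < n) x j ^+ (n - i.+1)) =
  \prod_(i < n) \prod_(j < n | (i < j)%N) (x i - x j).
Proof.
have rev_inj : injective (@rev_ord n) by apply: rev_ord_inj.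
pose s := perm rev_inj.
transitivity (\det (Vandermonde n (\row_j x (rev_ord j)))).
  rewrite -[RHS]mul1r -(sqrr_sign _ s) expr2 mulrAC -{1}(det_perm _ s).
  rewrite -odd_permV -(det_perm _ s^-1) -!det_mulmx -row_permE -col_permE.
  congr (\det _); apply/matrixP => i j; rewrite !mxE !permE rev_ordK.
  by congr (x j ^+ _).
rewrite det_Vandermonde (reindex_inj rev_ord_inj) /=.
under eq_bigr do rewrite (reindex_inj rev_ord_inj) /=.
rewrite (exchange_big_dep predT) //=; apply: eq_bigr => i _.
apply: eq_big => [j | j _]; first by have := ltn_ord i; have := ltn_ord j; lia.
by rewrite !mxE !rev_ordK.
Qed.

(** The change of basis from monomials to the [p k] is unitriangular. *)
Lemma det_monic_rev (R : comNzRingType) n (p : nat -> {poly R})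
    (z : 'I_n -> R) :
  (forall k, size (p k) = k.+1 /\ p k \is monic) ->
  \det (\matrix_(i < n, j < n) (p (n - i.+1)%N).[z j]) =
  \prod_(i < n) \prod_(j < n | (i < j)%N) (z i - z j).
Proof.
move=> pm; rewrite -det_Vandermonde_rev.
pose L := \matrix_(i < n, k < n) (p (n - i.+1)%N)`_(n - k.+1).
have -> : \matrix_(i < n, j < n) (p (n - i.+1)%N).[z j] =
    L *m \matrix_(i < n, j < n) z j ^+ (n - i.+1).
  apply/matrixP => i j; rewrite !mxE (horner_coef_wide (n := n)); last first.
    by rewrite (pm _).1; have := ltn_ord i; lia.
  rewrite (reindex_inj rev_ord_inj) /=; apply: eq_bigr => k _.
  by rewrite !mxE.
rewrite det_mulmx -[\det L]det_tr det_trig ?big1 ?mul1r // => [i _|].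
  by have [s /monicP] := pm (n - i.+1)%N; rewrite !mxE lead_coefE s.
apply/is_trig_mxP => i j ij; rewrite !mxE nth_default // (pm _).1.
by have := ltn_ord j; lia.
Qed.

Section WeylC.
Variable R : comNzRingType.

(* The pair (U_(k-1), U_k) of Chebyshev polynomials of the second kind,      *)
(* rescaled to be monic: U_k(2 cos a) = sin((k + 1) a) / sin a.               *)
Fixpoint chebyshev2 (k : nat) : {poly R} * {poly R} :=
  if k is k'.+1 then
    let: (q, p) := chebyshev2 k' in (p, 'X * p - q)
  else (0, 1).

Lemma size_chebyshev2 k : [/\ (size (chebyshev2 k).1 <= k)%N,
  size (chebyshev2 k).2 = k.+1 & (chebyshev2 k).2 \is monic].
Proof.
elim: k => [|k] /=; first by rewrite size_poly0 size_poly1 monic1.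
case: (chebyshev2 k) => q p /= [sq sp pm]; rewrite sp; split => //.
  rewrite size_polyDl mulrC size_mulX ?monic_neq0 ?sp // size_polyN.
  exact: leq_ltn_trans sq _.
rewrite monicE lead_coefDl -/(lead_coef _) mulrC.
  by rewrite lead_coefMX -monicE.
rewrite size_mulX ?monic_neq0 // sp size_polyN.
exact: leq_ltn_trans sq _.
Qed.
End WeylC.

(** Both sides satisfy the same three-term recurrence with multiplier y + 1/y, hence the joint
    induction on two consecutive terms. *)
Lemma horner_chebyshev2 (K : fieldType) (y : K) k : y != 0 ->
  (y - y^-1) * (chebyshev2 K k).1.[y + y^-1] = y ^+ k - y ^- k /\
  (y - y^-1) * (chebyshev2 K k).2.[y + y^-1] = y ^+ k.+1 - y ^- k.+1.
Proof.
move=> y0; elim: k => [|k] /=.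
  by rewrite horner0 mulr0 expr0 invr1 subrr hornerC mulr1 expr1.
case: (chebyshev2 K k) => q p /= [Eq Ep]; split=> //.
rewrite !hornerE mulrBr Eq mulrCA Ep !exprS; field.
by rewrite y0 expf_neq0.
Qed.

(** Column j is y_j - 1/y_j times monic polynomials in z_j = y_j + 1/y_j, and z_i - z_j = (y_i -
    y_j)(1 - 1/(y_i y_j)). *)
Lemma det_Weyl_denominator_C (K : fieldType) n (y : 'I_n -> K) :
  (forall j, y j != 0) ->
  \det (\matrix_(i < n, j < n) (y j ^+ (n - i.+1).+1 - y j ^- (n - i.+1).+1)) =
  (\prod_(j < n) (y j - (y j)^-1)) *
  \prod_(i < n) \prod_(j < n | (i < j)%N)
    ((y i - y j) * (1 - (y i)^-1 * (y j)^-1)).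
Proof.
move=> y0.
pose z j := y j + (y j)^-1.
pose D := \row_j (y j - (y j)^-1).
pose M := \matrix_(i < n, j < n) (chebyshev2 K (n - i.+1)).2.[z j].
have -> : \matrix_(i < n, j < n) (y j ^+ (n - i.+1).+1 - y j ^- (n - i.+1).+1)
    = M *m diag_mx D.
  apply/matrixP => i j.
  by rewrite mul_mx_diag !mxE mulrC (horner_chebyshev2 _ (y0 j)).2.
rewrite det_mulmx det_diag mulrC; congr (_ * _).
  by apply: eq_bigr => j _; rewrite mxE.
rewrite (@det_monic_rev _ _ (fun k => (chebyshev2 K k).2)) => [|k]; last first.
  by have [] := size_chebyshev2 K k.
apply: eq_bigr => i _; apply: eq_bigr => j _.
by rewrite /z; field; rewrite !y0.
Qed.

(** * Powers of the variables modulo their monic polynomial *)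

Section PowerReduction.
Variables (n : nat) (R : comNzRingType).
Local Notation P := (fps n R).
Implicit Types p q : {poly P}.

(** Order for the grading in which ['X] has weight 1, like the series variables. *)
Definition poly_order d p := forall k, fps_order (d - k) p`_k.

Lemma poly_orderM d e p q :
  poly_order d p -> poly_order e q -> poly_order (d + e) (p * q).
Proof.
move=> pd qe k; rewrite coefM; apply: fps_order_sum => j _.
apply: fps_order_le (fps_orderM (pd j) (qe (k - j)%N)).
by have := ltn_ord j; lia.
Qed.

Lemma poly_orderX : poly_order 1 'X.
Proof.
move=> k; rewrite coefX; case: eqP => [-> | _] //.
Qed.

Lemma poly_orderXsubX i : poly_order 1 ('X - (fpsX R i)%:P).
Proof.
move=> k; rewrite coefB coefC; apply: fps_orderB; first exact: poly_orderX.
case: eqP => [-> | _]; last exact: fps_order0.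
by rewrite -(expr1 (fpsX R i)); apply: fps_orderX.
Qed.

Definition root_poly : {poly P} := \prod_(j < n) ('X - (fpsX R j)%:P).

Lemma poly_order_root : poly_order n root_poly.
Proof.
(* The bound [n] becomes a sum of ones, one for each linear factor. *)
rewrite /root_poly -{1}(card_ord n) -sum1_card.
apply: (big_ind2 poly_order) => [k | d p e q pd qe|i _].
- by rewrite sub0n.
- exact: poly_orderM.
- exact: poly_orderXsubX.
Qed.

Lemma size_root_poly : size root_poly = n.+1.
Proof. by rewrite size_prod_XsubC /index_enum -enumT size_enum_ord. Qed.

Lemma monic_root_poly : root_poly \is monic.
Proof. exact: monic_prod_XsubC. Qed.

Lemma horner_root_poly j : root_poly.[fpsX R j] = 0.
Proof. by rewrite horner_prod (bigD1 j) //= hornerXsubC subrr mul0r. Qed.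

(* For [0 < n], the remainder of ['X^k] modulo [root_poly]. Its [p]-th        *)
(* coefficient is homogeneous of degree [k - p], although only a lower bound  *)
(* on the degree matters here.                                                *)
Fixpoint pow_red k : {poly P} :=
  if k is k'.+1 then 'X * pow_red k' - (pow_red k')`_n.-1 *: root_poly else 1.

Lemma size_pow_red k : (0 < n)%N -> (size (pow_red k) <= n)%N.
Proof.
move=> n0; elim: k => [|k IH] /=; first by rewrite size_poly1.
apply/leq_sizeP => i; rewrite leq_eqVlt coefB coefXM coefZ => /predU1P[<- | ni].
  have := monic_root_poly; rewrite monicE lead_coefE size_root_poly => /eqP->.
  by rewrite mulr1 gtn_eqF // subrr.
rewrite [root_poly`_i]nth_default ?size_root_poly // mulr0 subr0.
by case: i ni => //= i ni; rewrite nth_default // (leq_trans IH).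
Qed.

(** The subtracted multiple of [root_poly] has weight k - (n - 1) + n = k + 1, the same as
    ['X * pow_red k]. *)
Lemma poly_order_pow_red k : (0 < n)%N -> poly_order k (pow_red k).
Proof.
move=> n0; elim: k => [|k IH] /=; first by move=> i; rewrite sub0n.
move=> i; rewrite coefB; apply: fps_orderB.
  exact: (poly_orderM poly_orderX).
rewrite coefZ.
have H := fps_orderM (IH n.-1) (@poly_order_root i).
apply: fps_order_le H; lia.
Qed.

Lemma horner_pow_red k j : (pow_red k).[fpsX R j] = fpsX R j ^+ k.
Proof.
elim: k => [|k IH] /=; first by rewrite hornerC.
rewrite hornerD hornerN hornerZ horner_root_poly mulr0 subr0 mulrC hornerMX.
by rewrite IH exprSr.
Qed.

Lemma fpsX_pow_red k j :
  fpsX R j ^+ k = \sum_(p < n) (pow_red k)`_p * fpsX R j ^+ p.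
Proof.
rewrite -horner_pow_red; apply/horner_coef_wide/size_pow_red.
exact: leq_ltn_trans (ltn_ord j).
Qed.

Lemma fps_order_pow_red k (p : 'I_n) : fps_order (k - n) (pow_red k)`_p.
Proof.
have pn := ltn_ord p.
have n0 : (0 < n)%N by lia.
have H := @poly_order_pow_red k n0 p.
apply: (fps_order_le _ H); lia.
Qed.

End PowerReduction.

(** * Partitions as strictly decreasing exponents *)

Lemma pexp_decreasing n (l : partition_le n) (i j : 'I_n) :
  (i < j)%N -> (pexp l j < pexp l i)%N.
Proof.
move=> ij; have tr : transitive geq.
  by move=> a b c /= h1 h2; apply: leq_trans h2 h1.
have := sorted_ltn_nth tr 0%N (valP l) i j.
rewrite !inE !size_tuple !ltn_ord => /(_ isT isT ij).
rewrite -!tnth_nth /pexp /part /=; have := ltn_ord j; lia.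
Qed.

Lemma pexp_inj n (l l' : partition_le n) : pexp l =1 pexp l' -> l = l'.
Proof.
move=> ll'; apply/val_inj/eq_from_tnth => i.
by have := ll' i; rewrite /pexp /part; lia.
Qed.

Lemma partition_of_decreasing n N (f : {ffun 'I_n -> 'I_N}) :
  decreasing_ffun f -> exists l : partition_le n, forall i, pexp l i = f i.
Proof.
move/decreasing_ffunP => fd.
(* There are [n - i.+1] smaller naturals after [f i], so subtracting the staircase below is never
   truncated. *)
have fge k (i : 'I_n) : (k = n - i.+1 -> k <= f i)%N.
  elim: k i => // k IH i ki.
  have i1n : (i.+1 < n)%N by lia.
  by apply: leq_ltn_trans (fd i (Ordinal i1n) (leqnn _)); apply: IH => /=; lia.
have ls : sorted geq [tuple (f i - (n - i.+1))%N | i < n].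
  apply/(sortedP 0%N) => i; rewrite size_tuple => i1n.
  have i0n := ltnW i1n.
  rewrite -[i]/(val (Ordinal i0n)) -[i.+1]/(val (Ordinal i1n)).
  rewrite -!tnth_nth !tnth_mktuple /=.
  have := fd (Ordinal i0n) (Ordinal i1n) (leqnn _).
  lia.
exists (exist (fun l : n.-tuple nat => sorted geq l) _ ls) => i.
by rewrite /pexp /part /= tnth_mktuple subnK // fge.
Qed.

(** * Summation of the symplectic Schur kernel *)

Section LittlewoodCauchy.
Variables (K : fieldType) (n : nat) (t u : K) (y : 'I_n -> K).
Local Notation P := (fps n K).
Local Notation C := (@fpsC n K).
Local Notation X := (fpsX K).

(** The c_(k,q), with the index reversed to follow the rows of the Schur denominator. *)
Definition pow_coef k (q : 'I_n) : P := (pow_red n K k)`_(n - q.+1).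

Lemma fpsX_pow_coef k j :
  X j ^+ k = \sum_(q < n) pow_coef k q * X j ^+ (n - q.+1).
Proof. by rewrite fpsX_pow_red (reindex_inj rev_ord_inj). Qed.

Lemma fps_order_pow_coef k q : fps_order (k - n) (pow_coef k q).
Proof. exact: (fps_order_pow_red _ (rev_ord q)). Qed.

Definition kernel_coef k j : K :=
  (1 - u * t ^+ k) * (y j ^+ k.+1 - y j ^- k.+1).

Definition kernel_mx : 'M[P]_n :=
  \matrix_(q, j) fps_series n (fun k => pow_coef k q * C (kernel_coef k j)).

Lemma kernel_mx_trunc N q j : fps_order (N - n)
  (kernel_mx q j - \sum_(k < N) pow_coef k q * C (kernel_coef k j)).
Proof.
pose F k := pow_coef k q * C (kernel_coef k j).
rewrite mxE; apply: (fps_seriesP (F := F)).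
by move=> k; apply/fps_orderMr/fps_order_pow_coef.
Qed.

(** The sum splits into four geometric sums of ratios Xi Y, Xi Y', Xi T Y and Xi T Y', each inverse
    to 1 minus its ratio up to order [d]. *)
Lemma kernel_geometric_sum d (Xi Y Y' T U : P) :
    Y * Y' = 1 -> fps_order d (Xi ^+ d) ->
  fps_order d
    ((\sum_(k < d) (1 - U * T ^+ k) * (Y ^+ k.+1 - Y' ^+ k.+1) * Xi ^+ k) *
     ((1 - Xi * Y) * (1 - T * Xi * Y) * (1 - Xi * Y') * (1 - T * Xi * Y')) -
   (Y - Y') * (1 - U + (U - T) * (Xi * Y + Xi * Y') + (T ^+ 2 - U) * Xi ^+ 2)).
Proof.
move=> YY' Xd; pose G (z : P) := \sum_(k < d) z ^+ k.
have Gd z : fps_order d (1 - (1 - Xi * z) * G (Xi * z)).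
  rewrite /G -[1 - Xi * z]opprB mulNr -subrX1 opprK addrC subrK exprMn.
  exact: fps_orderMr.
have -> : \sum_(k < d) (1 - U * T ^+ k) * (Y ^+ k.+1 - Y' ^+ k.+1) * Xi ^+ k =
    Y * G (Xi * Y) - Y' * G (Xi * Y') -
      U * (Y * G (Xi * (T * Y)) - Y' * G (Xi * (T * Y'))).
  rewrite /G !mulr_sumr -!sumrB !mulr_sumr -!sumrB; apply: eq_bigr => k _.
  by rewrite !exprMn !exprS; ring.
move: (Gd Y) (Gd Y') (Gd (T * Y)) (Gd (T * Y')).
set g1 := G (Xi * Y); set g2 := G (Xi * Y').
set g3 := G (Xi * (T * Y)); set g4 := G (Xi * (T * Y')) => G1 G2 G3 G4.
(* An explicit combination of [Y * Y' - 1] and the four defects of order [d]. *)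
rewrite (_ : _ - _ = (Y - Y') * ((T ^+ 2 - U) * Xi ^+ 2) * (Y * Y' - 1)
  - (Y * (1 - T * Xi * Y) * (1 - Xi * Y') * (1 - T * Xi * Y')) *
      (1 - (1 - Xi * Y) * g1)
  + (Y' * (1 - Xi * Y) * (1 - T * Xi * Y) * (1 - T * Xi * Y')) *
      (1 - (1 - Xi * Y') * g2)
  + (U * Y * (1 - Xi * Y) * (1 - Xi * Y') * (1 - T * Xi * Y')) *
      (1 - (1 - Xi * (T * Y)) * g3)
  - (U * Y' * (1 - Xi * Y) * (1 - T * Xi * Y) * (1 - Xi * Y')) *
      (1 - (1 - Xi * (T * Y')) * g4)); last by ring.
rewrite YY' subrr mulr0 add0r.
by apply: fps_orderB; [do !apply: fps_orderD; first apply: fps_orderN |];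
  apply: fps_orderMl.
Qed.

Definition kernel_num (i j : 'I_n) : P :=
  1 - C u + (C u - C t) * (X i * C (y j) + X i * C (y j)^-1)
    + (C t ^+ 2 - C u) * X i ^+ 2.

Definition kernel_den (i j : 'I_n) : P :=
  (1 - X i * C (y j)) * (1 - C t * X i * C (y j)) *
  (1 - X i * C (y j)^-1) * (1 - C t * X i * C (y j)^-1).

Definition vandermonde_mx : 'M[P]_n := \matrix_(i < n, j < n) X j ^+ (n - i.+1).

Lemma kernel_mxE i j : y j != 0 ->
  (vandermonde_mx^T *m kernel_mx) i j * kernel_den i j =
  C (y j - (y j)^-1) * kernel_num i j.
Proof.
move=> yj0; apply: fps_order_eq => d.
(* Reduction of powers loses up to [n] in the order, so [d + n] terms give precision [d]. *)
pose S := \sum_(k < d + n) C (kernel_coef k j) * X i ^+ k.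
pose E := (vandermonde_mx^T *m kernel_mx) i j.
have ES : fps_order d (E - S).
  rewrite /E /S; under [X in _ - X]eq_bigr do rewrite fpsX_pow_coef mulr_sumr.
  rewrite exchange_big mxE -sumrB; apply: fps_order_sum => q _.
  rewrite (_ : _ - _ = vandermonde_mx^T i q * (kernel_mx q j -
      \sum_(k < d + n) pow_coef k q * C (kernel_coef k j))).
    by apply: fps_orderMl; rewrite -{1}(addnK n d); apply: kernel_mx_trunc.
  rewrite mulrBr mulr_sumr; congr (_ - _); apply: eq_bigr => k _.
  by rewrite !mxE; ring.
rewrite -/E -[E](subrK S) mulrDl -addrA; apply: fps_orderD.
  exact: fps_orderMr.
apply: (@fps_order_le _ _ (d + n)); first exact: leq_addr.
have YY' : C (y j) * C (y j)^-1 = 1 by rewrite -rmorphM /= divff ?rmorph1.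
have := kernel_geometric_sum (C t) (C u) YY' (@fps_orderX n K (d + n) i).
rewrite rmorphB; congr (fps_order _ (_ * _ - _)); apply: eq_bigr => k _.
by rewrite /kernel_coef !(rmorphM, rmorphB, rmorph1, rmorphXn) -exprVn rmorphXn.
Qed.

Definition schur_fps (l : partition_le n) : P :=
  \det (\matrix_(i < n, q < n) pow_coef (pexp l i) q).

Lemma alternant_schur_fps l :
  \det (\matrix_(i < n, j < n) X j ^+ pexp l i) =
  schur_fps l * \det vandermonde_mx.
Proof.
rewrite -det_mulmx; congr (\det _); apply/matrixP => i j.
by rewrite !mxE fpsX_pow_coef; apply: eq_bigr => q _; rewrite !mxE.
Qed.

Lemma fps_order_schur_fps l i : fps_order (pexp l i - n) (schur_fps l).
Proof.
apply: (@fps_order_det_row _ _ _ _ _ i) => j; rewrite mxE.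
exact: fps_order_pow_coef.
Qed.

Definition sp_den : K :=
  \det (\matrix_(i < n, j < n) (y j ^+ (n - i.+1).+1 - y j ^- (n - i.+1).+1)).

Definition summand_fps (l : partition_le n) : P :=
  C ((\prod_(i < n) (1 - u * t ^+ pexp l i)) * sp_schur y l) * schur_fps l.

Lemma det_kernel_coef l :
  \det (\matrix_(i < n, j < n) kernel_coef (pexp l i) j) / sp_den =
  (\prod_(i < n) (1 - u * t ^+ pexp l i)) * sp_schur y l.
Proof.
rewrite mulrA; congr (_ / _).
rewrite (_ : \matrix_(i, j) _ = diag_mx (\row_i (1 - u * t ^+ pexp l i)) *m
  \matrix_(i < n, j < n) (y j ^+ (pexp l i).+1 - y j ^- (pexp l i).+1)).
  rewrite det_mulmx det_diag; congr (_ * _).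
  by apply: eq_bigr => i _; rewrite mxE.
by apply/matrixP => i j; rewrite mul_diag_mx !mxE.
Qed.

Lemma has_sum_summand_fps :
  fps_has_sum summand_fps (\det kernel_mx * C sp_den^-1).
Proof.
(* With this [N], both the truncation error and every partition with an exponent at least [N] have
   order at least [N - n], which exceeds [mdeg m]. *)
move=> m; pose N := (mdeg m + n).+1.
pose D := [pred f : {ffun 'I_n -> 'I_N} | decreasing_ffun f].
have /choice[lam lamE] : forall f : {ffun 'I_n -> 'I_N},
    exists l : partition_le n, D f -> forall i, pexp l i = f i.
  move=> f; have [/partition_of_decreasing[l lf] | nf] := boolP (D f).
    by exists l.
  (* The zero partition is a dummy value where [f] is not decreasing. *)
  have z_sorted : sorted geq [tuple of nseq n 0%N] by elim: (n) => // -[].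
  by exists (exist (fun l : n.-tuple nat => sorted geq l) _ z_sorted).
exists [seq lam f | f <- enum D]; split.
- rewrite map_inj_in_uniq ?enum_uniq // => f g; rewrite !mem_enum => fD gD fg.
  apply/ffunP => i; apply: val_inj; rewrite /= -(lamE f fD) -(lamE g gD).
  by rewrite fg.
- move=> l lN; have [i /negP iN] : exists i, ~ (pexp l i < N)%N.
    apply/existsNP => lt_lN; case/negP: lN; apply/mapP.
    pose f : {ffun 'I_n -> 'I_N} := [ffun i => Ordinal (lt_lN i)].
    have fD : D f.
      by apply/decreasing_ffunP => i j ij; rewrite !ffunE /= pexp_decreasing.
    exists f; first by rewrite mem_enum.
    by apply: pexp_inj => i; rewrite (lamE f fD) ffunE.
  have lo : fps_order (pexp l i - n) (summand_fps l).
    exact/fps_orderMl/fps_order_schur_fps.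
  by apply: lo; move: iN; rewrite /N; lia.
rewrite big_map big_enum.
pose A := \matrix_(q < n, k < N) pow_coef k q.
pose B := \matrix_(k < N, j < n) C (kernel_coef k j).
have AB : fps_order (mdeg m).+1 (\det kernel_mx - \det (A *m B)).
  apply: fps_order_subr_det => q j.
  rewrite (_ : (mdeg m).+1 = N - n)%N; last by rewrite /N; lia.
  have := @kernel_mx_trunc N q j; congr (fps_order _ (_ - _)).
  by rewrite mxE; apply: eq_bigr => k _; rewrite !mxE.
have -> : fps_coef (\det kernel_mx * C sp_den^-1) m =
    fps_coef (\det (A *m B) * C sp_den^-1) m.
  apply/eqP; rewrite -subr_eq0; apply/eqP.
  have := fps_orderMr (C sp_den^-1) AB (ltnSn (mdeg m)).
  by rewrite mulrBl.
rewrite det_mulmx_Cauchy_Binet mulr_suml fps_coef_sum; apply: eq_bigr => f fD.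
congr (fps_coef _ m); rewrite /summand_fps -det_kernel_coef rmorphM /=.
have -> : \det (colsub f A) = schur_fps (lam f).
  by rewrite -det_tr; congr (\det _); apply/matrixP => i q; rewrite !mxE lamE.
have -> : \det (rowsub f B) =
    C (\det (\matrix_(i < n, j < n) kernel_coef (pexp (lam f) i) j)).
  rewrite -det_map_mx; congr (\det _).
  by apply/matrixP => i j; rewrite !mxE lamE.
by ring.
Qed.

(** * Passage to the fraction field *)

Hypotheses (y0 : forall j, y j != 0) (y1 : forall j, y j - (y j)^-1 != 0).

Local Notation F := {fraction P}.
Local Notation tof := (@FracField.tofrac P).
Let phi : {rmorphism K -> F} := tof \o C.
Let x (i : 'I_n) : F := tof (X i).

(** Its constant coefficient is 1; this makes the denominators of the matrix entries nonzero. *)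
Lemma subr1_fpsX_neq0 i (f : P) : 1 - X i * f != 0.
Proof.
have : fps_order 1 (X i * f).
  by apply: fps_orderMr; rewrite -(expr1 (X i)); apply: fps_orderX.
move=> /(_ 0%MM); rewrite mdeg0 => /(_ isT) Xf.
apply/eqP => /(congr1 (fun g => fps_coef g 0%MM)).
rewrite -[LHS]/(1 *+ (0%MM == 0%MM) - fps_coef (X i * f) 0%MM) Xf eqxx subr0.
by move=> /eqP; rewrite oner_eq0.
Qed.

Lemma det_vandermonde_mx_neq0 : \det vandermonde_mx != 0.
Proof.
rewrite det_Vandermonde_rev; apply/prodf_neq0 => i _; apply/prodf_neq0 => j ij.
rewrite subr_eq0; apply/eqP => /(congr1 (fun f => fps_coef f U_(i)%MM)) /=.
rewrite eqxx eq_mnm1; case: eqP => [ji | _ /eqP]; last by rewrite oner_eq0.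
by rewrite ji ltnn in ij.
Qed.

Lemma formal_sum_schur_sp :
  formal_sum
    (fun l : partition_le n =>
       (\prod_(i < n) (1 - phi u * phi t ^+ pexp l i)) * schur x l *
       sp_schur (fun j => phi (y j)) l)
    (\det (\matrix_(i < n, j < n)
        ((1 - phi u + (phi u - phi t) * (x i * phi (y j) + x i * (phi (y j))^-1)
            + (phi t ^+ 2 - phi u) * x i ^+ 2) /
         ((1 - x i * phi (y j)) * (1 - phi t * x i * phi (y j)) *
          (1 - x i * (phi (y j))^-1) * (1 - phi t * x i * (phi (y j))^-1)))) /
     \prod_(i < n) \prod_(j < n | (i < j)%N)
       ((x i - x j) * (phi (y i) - phi (y j)) *
          (1 - (phi (y i))^-1 * (phi (y j))^-1))).
Proof.
have alternantE (e : 'I_n -> nat) :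
    \det (\matrix_(i < n, j < n) x j ^+ e i) =
    tof (\det (\matrix_(i < n, j < n) X j ^+ e i)).
  rewrite -det_map_mx; congr (\det _); apply/matrixP => i j.
  by rewrite !mxE rmorphXn.
have V0 : tof (\det vandermonde_mx) != 0.
  by rewrite tofrac_eq0 det_vandermonde_mx_neq0.
exists summand_fps, (\det kernel_mx * C sp_den^-1); split.
- move=> l; rewrite /summand_fps rmorphM mulrAC; congr (_ * _).
    rewrite -[RHS]/(phi _) rmorphM rmorph_prod; congr (_ * _).
      by apply: eq_bigr => i _; rewrite rmorphB rmorph1 rmorphM rmorphXn.
    rewrite /sp_schur fmorph_div -!det_map_mx.
    by congr (_ / _); congr (\det _);
      apply/matrixP => i j; rewrite !mxE rmorphB fmorphV !rmorphXn.
  rewrite /schur !alternantE alternant_schur_fps rmorphM -/vandermonde_mx.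
  by rewrite mulfK.
- set Dm := \matrix_(i < n, j < n) _.
  (* Entrywise this is [kernel_mxE] divided by [kernel_den]; its determinant links [\det Dm] to
     [\det kernel_mx]. *)
  have DmE : map_mx tof (vandermonde_mx^T *m kernel_mx) =
      Dm *m diag_mx (\row_j phi (y j - (y j)^-1)).
    apply/matrixP => i j; rewrite mul_mx_diag [LHS]mxE !mxE.
    have den0 : tof (kernel_den i j) != 0.
      rewrite tofrac_eq0 /kernel_den !(mulrC (C t)) -!(mulrA (X i)).
      by rewrite !mulf_neq0 ?subr1_fpsX_neq0.
    apply: (mulIf den0); rewrite -rmorphM.
    have := kernel_mxE i (y0 j); rewrite !mxE => ->.
    rewrite rmorphM mulrAC [RHS]mulrC; congr (_ * _).
    have numE : tof (kernel_num i j) =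
        1 - phi u + (phi u - phi t) * (x i * phi (y j) + x i * (phi (y j))^-1)
            + (phi t ^+ 2 - phi u) * x i ^+ 2.
      rewrite -fmorphV /kernel_num.
      by rewrite !(rmorphXn, rmorphD, rmorphN, rmorphM, rmorph1).
    have denE : tof (kernel_den i j) =
        (1 - x i * phi (y j)) * (1 - phi t * x i * phi (y j)) *
          (1 - x i * (phi (y j))^-1) * (1 - phi t * x i * (phi (y j))^-1).
      by rewrite -fmorphV /kernel_den !(rmorphM, rmorphB, rmorph1).
    by rewrite -numE -denE divfK.
  have /(congr1 determinant) := DmE.
  rewrite det_map_mx !det_mulmx det_tr det_diag rmorphM.
  have -> : \prod_j (\row_j phi (y j - (y j)^-1)) 0 j =
      phi (\prod_j (y j - (y j)^-1)).
    by rewrite rmorph_prod; apply: eq_bigr => j _; rewrite mxE.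
  have Y0 : phi (\prod_j (y j - (y j)^-1)) != 0.
    by rewrite fmorph_eq0; apply/prodf_neq0 => j _.
  move=> detE; rewrite -[\det Dm](mulfK Y0) -detE.
  have -> : \prod_(i < n) \prod_(j < n | (i < j)%N)
       ((x i - x j) * (phi (y i) - phi (y j)) *
          (1 - (phi (y i))^-1 * (phi (y j))^-1)) =
      tof (\det vandermonde_mx) *
      phi (\prod_(i < n) \prod_(j < n | (i < j)%N)
        ((y i - y j) * (1 - (y i)^-1 * (y j)^-1))).
    rewrite det_Vandermonde_rev !rmorph_prod -big_split; apply: eq_bigr => i _.
    rewrite !rmorph_prod -big_split; apply: eq_bigr => j _.
    rewrite -!fmorphV [in RHS]rmorphB -mulrA [in RHS]rmorphM !rmorphB rmorph1.
    by rewrite [phi (_ * _)]rmorphM.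
  rewrite /sp_den det_Weyl_denominator_C // [RHS]rmorphM.
  rewrite -[X in _ = _ * X]/(phi _) fmorphV [phi (_ * _)]rmorphM.
  set V := tof (\det vandermonde_mx) in V0 *.
  set Y := phi _ in Y0 *; set W := phi _.
  by rewrite !invfM -!mulrA mulrCA; congr (_ * _); rewrite mulrCA mulVKf.
exact: has_sum_summand_fps.
Qed.
End LittlewoodCauchy.

Theorem theorem9 (R : idomainType) (n : nat) :
  let t : seriesF R n := ind_t R n in
  let u : seriesF R n := ind_u R n in
  let x : 'I_n -> seriesF R n := @ind_x R n in
  let y : 'I_n -> seriesF R n := @ind_y R n in
  formal_sum
    (fun l : partition_le n =>
       (\prod_(i < n) (1 - u * t ^+ pexp l i)) * schur x l * sp_schur y l)
    (\det (\matrix_(i < n, j < n)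
        ((1 - u + (u - t) * (x i * y j + x i * (y j)^-1)
            + (t ^+ 2 - u) * x i ^+ 2) /
         ((1 - x i * y j) * (1 - t * x i * y j) *
          (1 - x i * (y j)^-1) * (1 - t * x i * (y j)^-1)))) /
     \prod_(i < n) \prod_(j < n | (i < j)%N)
       ((x i - x j) * (y i - y j) * (1 - (y i)^-1 * (y j)^-1))).
Proof.
move=> t u x y.
pose yK (j : 'I_n) : coefF R n := FracField.tofrac 'X_(rshift 2 j).
have yK0 j : yK j != 0.
  rewrite tofrac_eq0; apply/eqP => /(congr1 (mcoeff U_(rshift 2 j))) /eqP.
  by rewrite mcoeffX eqxx mcoeff0 oner_eq0.
apply: (formal_sum_schur_sp (FracField.tofrac 'X_(lshift n 0))
  (FracField.tofrac 'X_(lshift n 1)) yK0) => j.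
rewrite subr_eq0; apply/eqP => yV.
(* An indeterminate cannot square to 1: the constant coefficients differ. *)
have : yK j ^+ 2 = 1 by rewrite expr2 {2}yV divff.
rewrite -rmorphXn -(rmorph1 (@FracField.tofrac _)) => /eqP.
rewrite tofrac_eq mpolyXn => /eqP/(congr1 (mcoeff 0)).
rewrite mcoeffX mcoeff1 eqxx -mdeg_eq0 mdegMn mdeg1 => /eqP.
by rewrite eq_sym oner_eq0.
Qed.
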